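(* Let $a,m\in\mathbb R$ and $n\in\mathbb N$. Let $\mathcal A$ be a non-empty family of subsets of $[n]$ with $\varnothing\notin\mathcal A$. Suppose that $ak+m\neq 0$ for all integers $k$ with $\min_{A\in\mathcal A}|A|\leq k\leq n$. Then $$\sum_{X\in U_n(\mathcal A)}\bigl(a|Z_{\mathcal A}(X)|+m\bigr)\,g_{a,m}(n,|X|)=1.$$
   Context: $[n]=\{1,2,\dots,n\}$, with $n\geq 1$. For a non-empty family $\mathcal F$ of subsets of $[n]$, the upset is $U_n(\mathcal F)=\{Y\subseteq[n] : Y\supseteq F \text{ for some } F\in\mathcal F\}$. For $X\subseteq[n]$, set $Z_{\mathcal F}(X)=\varnothing$ if $X\notin U_n(\mathcal F)$, and $Z_{\mathcal F}(X)=\bigcap_{F\in\mathcal F,\,F\subseteq X}F$ otherwise. For $a,m\in\mathbb R$ and integers $l\leq n$ such that $ak+m\neq 0$ for $k=l,l+1,\dots,n$, define $$g_{a,m}(n,l)=\frac{(n-l)!\,a^{n-l}}{\prod_{k=l}^{n}(ak+m)},$$ with the convention $a^0=1$ (including $0^0=1$). *)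

(* Defs.v *)
From HB Require Import structures.
From mathcomp Require Import all_boot all_order all_algebra.
From mathcomp Require Import reals.
Set Implicit Arguments.
Unset Strict Implicit.
Unset Printing Implicit Defensive.

Import Order.TTheory GRing.Theory Num.Theory.

Local Open Scope ring_scope.

(* The ground set [n] = {1, .., n} is represented by 'I_n. *)

Definition upset (n : nat) (F : {set {set 'I_n}}) : {set {set 'I_n}} :=
  [set Y : {set 'I_n} | [exists A in F, A \subset Y]].

Definition Zset (n : nat) (F : {set {set 'I_n}}) (X : {set 'I_n}) :
    {set 'I_n} :=
  if X \in upset F then \bigcap_(A in F | A \subset X) A else set0.

(* Only meaningful for l <= n and a k + m <> 0 for l <= k <= n.  Since
   a ^+ 0 = 1 for every a, the convention 0^0 = 1 is built in. *)
Definition g (R : realType) (a m : R) (n l : nat) : R :=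
  ((n - l)`!%:R * a ^+ (n - l)) / \prod_(l <= k < n.+1) (a * k%:R + m).

(* The neutral value n is harmless, as #|A| <= n for all A; see
   [min_cardP]. *)
Definition min_card (n : nat) (F : {set {set 'I_n}}) : nat :=
  \big[minn/n]_(A in F) #|A|.

Lemma min_cardP (n : nat) (F : {set {set 'I_n}}) : F != set0 ->
  (exists2 A, A \in F & #|A| = min_card F) /\
  (forall A, A \in F -> (min_card F <= #|A|)%N).
Proof.
move=> /set0Pn[A0 A0F].
have lb A : A \in F -> (min_card F <= #|A|)%N.
  by move=> AF; rewrite /min_card -minEnat -leEnat; apply: bigmin_le_cond.
split=> //.
have [ex|eqn] : (exists2 A, A \in F & #|A| = min_card F) \/ min_card F = n.
- rewrite /min_card; apply: (big_ind (fun x =>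
    (exists2 A, A \in F & #|A| = x) \/ x = n)); first by right.
  + by move=> x y Hx Hy; rewrite /minn; case: ifP.
  + by move=> A AF; left; exists A.
- by [].
- exists A0 => //; apply/eqP; rewrite eqn_leq lb // andbT eqn.
  by rewrite -[X in (_ <= X)%N]card_ord max_card.
Qed.

(* Main.v *)
(* Put h(X) = (a|X| + m) g(n,|X|).  For X in the upset U, a point x of X lies in
   Z(X) iff X \ x is not in U, so a|Z(X)| = a|X| - a #{x in X | X \ x in U}.
   Double counting the pairs (X \ x, X) in U x U through the smaller set Y = X \ x,
   and using a (n - |Y|) g(n,|Y|+1) = h(Y) for Y <> [n], the subtracted terms sum
   to the sum of h over U minus [n], leaving only h([n]) = 1. *)
Require Import Defs.
From mathcomp Require Import all_boot all_order all_algebra.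
From mathcomp Require Import reals.
From mathcomp Require Import ring.
Set Implicit Arguments.
Unset Strict Implicit.
Unset Printing Implicit Defensive.
Import Order.TTheory GRing.Theory Num.Theory.
Local Open Scope ring_scope.

Lemma upsetP (n : nat) (F : {set {set 'I_n}}) (X : {set 'I_n}) :
  reflect (exists2 A, A \in F & A \subset X) (X \in upset F).
Proof. by rewrite inE; apply: exists_inP. Qed.

Lemma upsetS (n : nat) (F : {set {set 'I_n}}) (X Y : {set 'I_n}) :
  X \subset Y -> X \in upset F -> Y \in upset F.
Proof.
move=> XY /upsetP[A AF AX]; apply/upsetP; exists A => //.
exact: subset_trans AX XY.
Qed.

Lemma setT_upset (n : nat) (F : {set {set 'I_n}}) :
  F != set0 -> [set: 'I_n] \in upset F.
Proof. by move=> /set0Pn[A AF]; apply/upsetP; exists A; rewrite ?subsetT. Qed.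

Lemma min_card_le_upset (n : nat) (F : {set {set 'I_n}}) (X : {set 'I_n}) :
  X \in upset F -> (min_card F <= #|X|)%N.
Proof.
move=> /upsetP[A AF AX]; have F0 : F != set0 by apply/set0Pn; exists A.
exact: leq_trans ((min_cardP F0).2 A AF) (subset_leq_card AX).
Qed.

(** A member of [F] inside [X] avoids [x] exactly when it lies inside [X :\ x], so [x] belongs to
    all of them iff none fits in [X :\ x]. As [X] is in the upset, the intersection ranges over a
    non-empty family and hence stays inside [X]. *)
Lemma mem_Zset (n : nat) (F : {set {set 'I_n}}) (X : {set 'I_n}) (x : 'I_n) :
  X \in upset F -> (x \in Zset F X) = (x \in X) && (X :\ x \notin upset F).
Proof.
move=> XU; rewrite /Zset XU; apply/bigcapP/andP=> [xZ | [xX XxU] A /andP[AF AX]].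
  split; first by have /upsetP[A AF AX] := XU; apply: (subsetP AX); rewrite xZ ?AF.
  apply/negP=> /upsetP[A AF]; rewrite subsetD1 => /andP[AX].
  by rewrite xZ ?AF.
by apply: contraR XxU => xA; apply/upsetP; exists A; rewrite ?subsetD1 ?AX.
Qed.

Lemma card_Zset (n : nat) (F : {set {set 'I_n}}) (X : {set 'I_n}) :
  X \in upset F ->
  (#|Zset F X| + \sum_(x | (x \in X) && (X :\ x \in upset F)) 1)%N = #|X|.
Proof.
move=> XU; rewrite -!sum1_card [RHS](bigID (fun x => X :\ x \in upset F)) /=.
by rewrite addnC; congr (_ + _)%N; apply: eq_bigl => x; rewrite mem_Zset.
Qed.

(** Adding a point outside [Y] inverts removing a point of [X], and an upset is closed under adding
    points, so each [Y] is counted once for each of its [n - #|Y|] outside points. *)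
Lemma sum_upset_covers (V : nmodType) (n : nat) (F : {set {set 'I_n}})
    (f : nat -> V) :
  \sum_(X in upset F) \sum_(x | (x \in X) && (X :\ x \in upset F)) f #|X| =
  \sum_(Y in upset F) f #|Y|.+1 *+ (n - #|Y|).
Proof.
transitivity (\sum_(Y in upset F) \sum_(x | x \notin Y) f #|Y|.+1); last first.
  apply: eq_bigr => Y _; rewrite sumr_const; congr (_ *+ _).
  by rewrite -[n in (n - _)%N]card_ord -(cardC (mem Y)) addKn.
rewrite (exchange_big_dep predT) //= [RHS](exchange_big_dep predT) //=.
apply: eq_bigr => x _.
rewrite (reindex_onto (fun Y => x |: Y) (fun X => X :\ x)) /=; last first.
  by move=> X /and3P[_ xX _]; rewrite setD1K.
apply: eq_big => [Y|Y /andP[_ /eqP YE]]; last first.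
  by rewrite cardsU1 -YE setD11.
(* The reindexing keeps only the [Y] with [(x |: Y) :\ x = Y], that is, those missing [x]. *)
rewrite setU11 /=; have [xY|xY] := boolP (x \in Y).
  rewrite andbF; apply/negbTE/nandP; right.
  by apply: contraTneq xY => <-; rewrite setD11.
rewrite setU1K // eqxx !andbT; apply: andb_idl; apply: upsetS.
exact: subsetUr.
Qed.

(** Passing from [l] to [l.+1] drops the factor [a * l%:R + m] from the denominator and the factor
    [(n - l) * a] from the numerator. *)
Lemma g_rec (R : realType) (a m : R) (n l : nat) :
  (l < n)%N -> a * l%:R + m != 0 ->
  (a * l%:R + m) * g a m n l = a * g a m n l.+1 *+ (n - l).
Proof.
move=> ln nz; rewrite /g (@big_ltn _ _ _ l) ?ltnS ?(ltnW ln) //.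
have -> : (n - l = (n - l.+1).+1)%N by rewrite -subSS subSn.
set c := a * _ + m in nz *; set p := \prod_(_ <= _ < _) _; set d := (n - l.+1)%N.
rewrite factS exprS natrM invfM -[RHS]mulr_natl !mulrA; congr (_ / p).
by field.
Qed.

Lemma g_diag (R : realType) (a m : R) (n : nat) :
  a * n%:R + m != 0 -> (a * n%:R + m) * g a m n n = 1.
Proof. by move=> nz; rewrite /g subnn big_nat1 expr0 mulr1 mul1r divff. Qed.

Theorem theorem2p4 (R : realType) (a m : R) (n : nat) (n_ge1 : (1 <= n)%N)
    (F : {set {set 'I_n}}) (F_neq0 : F != set0) (set0_notin_F : set0 \notin F)
    (nz : forall k : nat, (min_card F <= k <= n)%N -> a * k%:R + m != 0) :
  \sum_(X in upset F) (a * #|Zset F X|%:R + m) * g a m n #|X| = 1.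
Proof.
have leN (X : {set 'I_n}) : (#|X| <= n)%N by rewrite -[n in (_ <= n)%N]card_ord max_card.
have nzU X : X \in upset F -> a * #|X|%:R + m != 0.
  by move=> XU; rewrite nz // min_card_le_upset // leN.
have TU := setT_upset F_neq0.
pose h (X : {set 'I_n}) := (a * #|X|%:R + m) * g a m n #|X|.
have hT : h [set: 'I_n] = 1 by have := nzU _ TU; rewrite /h cardsT card_ord; apply: g_diag.
have covers : \sum_(X in upset F) \sum_(x | (x \in X) && (X :\ x \in upset F))
    a * g a m n #|X| = \sum_(Y in upset F | Y != setT) h Y.
  (* The term [Y = setT] involves [g a m n n.+1], outside the range where [g] is meaningful, but its
     multiplicity is [n - n = 0]. *)
  rewrite (sum_upset_covers F (fun l => a * g a m n l)) (bigD1 setT) //=.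
  rewrite cardsT card_ord subnn mulr0n add0r; apply: eq_bigr => Y /andP[YU YT].
  rewrite /h g_rec ?nzU // ltn_neqAle leN andbT.
  by apply: contra YT => /eqP YE; rewrite eqEcard subsetT cardsT card_ord YE /=.
have split_sum : \sum_(X in upset F) h X =
    \sum_(X in upset F) (a * #|Zset F X|%:R + m) * g a m n #|X| +
    \sum_(Y in upset F | Y != setT) h Y.
  rewrite -covers -big_split /=; apply: eq_bigr => X XU.
  (* Only the [#|X|] in the linear factor is split; the one inside [g] stays. *)
  rewrite /h -{1}(card_Zset XU) sum1_card natrD sumr_const.
  by rewrite -[a * g a m n #|X| *+ _]mulr_natr; ring.
by move: split_sum; rewrite (bigD1 setT) //= hT => /addIr.
Qed.
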